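(* For each clique tree $G$ in $\mathcal{CT}$, the matrix $\mathcal E(G)$ is irreducible.
   Context: Graphs are finite, simple and undirected, with at least two vertices. A cut-vertex of a connected graph $G$ is a vertex whose removal disconnects $G$; a block of $G$ is a maximal connected subgraph $B$ having no cut-vertices of its own (no cut-vertex of $B$). A clique tree is a connected graph whose blocks are all complete graphs. $\mathcal{CT}$ is the class of clique trees $G$ such that each block of $G$ contains at most two cut-vertices of $G$. For a connected graph $G$, $d_G(u,v)$ is the distance and $e_G(u)=\max\{d_G(u,v)\mid v\in V_G\}$ the eccentricity of $u$. The eccentricity matrix $\mathcal E(G)=(\epsilon_{uv})$, indexed by $V_G\times V_G$, has $\epsilon_{uv}=d_G(u,v)$ if $d_G(u,v)=\min\{e_G(u),e_G(v)\}$ and $\epsilon_{uv}=0$ otherwise. A square matrix $M$ is reducible if there is a permutation matrix $P$ such that $M=P^\top\begin{pmatrix}A&B\\O&C\end{pmatrix}P$ with $A$ and $C$ square blocks having at least one row each; it is irreducible otherwise. *)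

(* Defs.v *)
From mathcomp Require Import all_boot all_order all_fingroup all_algebra.

Set Implicit Arguments.
Unset Strict Implicit.
Unset Printing Implicit Defensive.

Import GRing.Theory.
Local Open Scope ring_scope.

(* A simple graph is a symmetric irreflexive relation on a finType T.  Its
   subgraphs, and the graph itself, are handled as pairs (V, f) of a vertex set
   V : {set T} and an adjacency relation f : rel T, the graph itself being
   (setT, e). *)
Definition simple_graph (T : finType) (e : rel T) : Prop :=
  symmetric e /\ irreflexive e.

(* The empty graph counts as connected, so removing the vertex of a one-vertex
   graph does not disconnect it. *)
Definition connected_graph (T : finType) (V : {set T}) (f : rel T) : bool :=
  [forall x in V, forall y in V,
     connect [rel a b | [&& a \in V, b \in V & f a b]] x y].

Definition cut_vertex (T : finType) (V : {set T}) (f : rel T) (v : T) : bool :=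
  (v \in V) && ~~ connected_graph (V :\ v) f.

Definition subgraph (T : finType)
    (V1 : {set T}) (f1 : rel T) (V2 : {set T}) (f2 : rel T) : Prop :=
  V1 \subset V2 /\ subrel f1 f2.

(* (V, f) is a connected subgraph, not necessarily induced, of the graph e and
   has no cut-vertices of its own. *)
Definition nonseparable_subgraph (T : finType) (e : rel T)
    (V : {set T}) (f : rel T) : Prop :=
  [/\ simple_graph f,
      forall x y, f x y -> (x \in V) && (y \in V),
      subgraph V f setT e,
      connected_graph V f
    & forall v, ~~ cut_vertex V f v].

Definition block (T : finType) (e : rel T) (V : {set T}) (f : rel T) : Prop :=
  nonseparable_subgraph e V f /\
  forall (V' : {set T}) (f' : rel T),
    nonseparable_subgraph e V' f' -> subgraph V f V' f' -> subgraph V' f' V f.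

Definition complete_graph (T : finType) (V : {set T}) (f : rel T) : Prop :=
  {in V &, forall x y, x != y -> f x y}.

Definition clique_tree (T : finType) (e : rel T) : Prop :=
  connected_graph [set: T] e /\
  forall (V : {set T}) (f : rel T), block e V f -> complete_graph V f.

Definition in_CT (T : finType) (e : rel T) : Prop :=
  clique_tree e /\
  forall (V : {set T}) (f : rel T), block e V f ->
    (#|[set v in V | cut_vertex [set: T] e v]| <= 2)%N.

(* The least n such that some walk with n edges joins u to v.  In a connected
   graph n < #|T|; if no walk joins u to v, the value is #|T|. *)
Definition dist (T : finType) (e : rel T) (u v : T) : nat :=
  find (fun n => [exists p : n.-tuple T, path e u p && (last u p == v)])
       (iota 0 #|T|).

Definition eccentricity (T : finType) (e : rel T) (u : T) : nat :=
  \max_(v : T) dist e u v.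

(* The vertices index the rows and columns through the enumeration of T. *)
Definition eccentricity_mx (R : numDomainType) (T : finType) (e : rel T) :
    'M[R]_#|T| :=
  \matrix_(i < #|T|, j < #|T|)
    let u := enum_val i in
    let v := enum_val j in
    if dist e u v == minn (eccentricity e u) (eccentricity e v)
    then (dist e u v)%:R else 0.

Definition reducible_mx (R : numDomainType) (n : nat) (M : 'M[R]_n) : Prop :=
  exists (n1 n2 : nat) (def_n : (n1 + n2)%N = n) (P : 'M[R]_n)
         (A : 'M[R]_n1) (B : 'M[R]_(n1, n2)) (C : 'M[R]_n2),
    [/\ (0 < n1)%N, (0 < n2)%N, is_perm_mx P
      & M = P^T *m castmx (def_n, def_n) (block_mx A B 0 C) *m P].

Definition irreducible_mx (R : numDomainType) (n : nat) (M : 'M[R]_n) : Prop :=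
  ~ reducible_mx M.

(* Main.v *)
(* The distance of a clique tree is 0-hyperbolic.  Hence, if p, q realize the
   diameter, every vertex u has p or q among its farthest vertices, and an
   entry between u and a farthest vertex of u is nonzero because the
   eccentricity of the latter is at least that of u.  As the (p, q) entry is
   nonzero too, the graph of nonzero entries is connected.

   For hyperbolicity, the only input is that two neighbours of y that remain
   connected after removing y are adjacent: together with y they lie on a cycle,
   which is nonseparable and hence contained in a complete block.  With respect
   to a root r this makes the parent (the neighbour closer to r) unique, and
   shows that a geodesic from y to a vertex no deeper than y passes through the
   parent of y, unless it is an edge between two vertices of the same depth.  The
   ultrametric inequality for Gromov products follows by moving the deepest of
   the three vertices to its parent. *)
Require Import Defs.
From mathcomp Require Import all_boot all_order all_fingroup all_algebra.
From mathcomp Require Import zify.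

Set Implicit Arguments.
Unset Strict Implicit.
Unset Printing Implicit Defensive.

Import GRing.Theory Num.Theory.

(** * Distance and eccentricity in a connected graph *)

Section Distance.
Variables (T : finType) (e : rel T).
Hypothesis e_sym : symmetric e.
Hypothesis e_conn : connected_graph [set: T] e.

Lemma connectedT (x y : T) : connect e x y.
Proof.
have /forallP/(_ x)/implyP/(_ (in_setT x)) := e_conn.
move=> /forallP/(_ y)/implyP/(_ (in_setT y)).
by apply: connect_sub => a b /and3P[_ _ /connect1].
Qed.

Lemma dist_path (x : T) (p : seq T) :
  path e x p -> (dist e x (last x p) <= size p)%N.
Proof.
move=> xp; rewrite /dist; set a := (X in find X _).
have [lt_pT|le_Tp] := ltnP (size p) #|T|; last first.
  by apply: leq_trans le_Tp; rewrite -[leqRHS](size_iota 0); apply: find_size.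
rewrite leqNgt; apply/negP => /(before_find 0%N).
rewrite nth_iota // add0n /a => /negbT/negP[].
by apply/existsP; exists (in_tuple p); rewrite xp /=.
Qed.

(** A duplicate-free path has fewer than [#|T|] edges, so the bounded search in [dist] succeeds and
    its value is the length of an actual path. *)
Lemma geodesic (x y : T) :
  exists2 p, path e x p & y = last x p /\ size p = dist e x y.
Proof.
have /connectP[p0 xp0 ->] := connectedT x y.
case/shortenP: xp0 => p xp Up _.
rewrite /dist; set a := (X in find X _).
have has_a : has a (iota 0 #|T|).
  apply/hasP; exists (size p); rewrite ?/a; last first.
    by apply/existsP; exists (in_tuple p); rewrite xp /=.
  by rewrite mem_iota add0n /= (leq_trans _ (max_card (mem (x :: p)))) // (card_uniqP Up).
have lt_aT : (find a (iota 0 #|T|) < #|T|)%N by rewrite -{2}(size_iota 0 #|T|) -has_find.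
have /= := nth_find 0%N has_a.
rewrite nth_iota // add0n /a => /existsP[q /andP[xq /eqP lq]].
by exists q => //; rewrite size_tuple.
Qed.

Lemma dist_eq0 (x y : T) : (dist e x y == 0%N) = (x == y).
Proof.
apply/eqP/eqP => [d0|->].
  by have [p _ [yE]] := geodesic x y; rewrite d0 => /size0nil p0; rewrite yE p0.
by apply/eqP; rewrite -leqn0; apply: (@dist_path y [::]).
Qed.

Lemma distxx (x : T) : dist e x x = 0%N.
Proof. by apply/eqP; rewrite dist_eq0. Qed.

Lemma dist_triangle (y x z : T) : (dist e x z <= dist e x y + dist e y z)%N.
Proof.
have [p xp [yE <-]] := geodesic x y; have [q yq [-> <-]] := geodesic y z.
by rewrite -size_cat {1}yE -last_cat; apply: dist_path; rewrite cat_path xp -yE.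
Qed.

Lemma dist_sym (x y : T) : dist e x y = dist e y x.
Proof.
suff le x' y' : (dist e x' y' <= dist e y' x')%N by apply/eqP; rewrite eqn_leq !le.
have [p yp [xE <-]] := geodesic y' x'; rewrite xE.
have revp : path e (last y' p) (rev (belast y' p)).
  by rewrite rev_path; apply: sub_path yp => a b; rewrite e_sym.
have := dist_path revp; rewrite size_rev size_belast.
suff -> : last (last y' p) (rev (belast y' p)) = y' by [].
by case: p {xE yp revp} => //= a p; rewrite rev_cons last_rcons.
Qed.

Lemma dist_edge (x y z : T) : e x y -> (dist e x z <= (dist e y z).+1)%N.
Proof.
move=> xy; apply: leq_trans (dist_triangle y x z) _.
by rewrite -add1n leq_add2r; apply: (@dist_path x [:: y]); rewrite /= xy.
Qed.

Lemma dist_step (x z : T) : x != z ->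
  exists2 y, e x y & dist e x z = (dist e y z).+1.
Proof.
move=> x_z; have [[|y p]] := geodesic x z; first by move=> _ [zx]; rewrite zx eqxx in x_z.
move=> /= /andP[xy yp] [zE dE]; exists y => //.
apply/eqP; rewrite eqn_leq dist_edge // -dE ltnS zE; exact: dist_path.
Qed.

Lemma dist_le_ecc (x y : T) : (dist e x y <= eccentricity e x)%N.
Proof. exact: (leq_bigmax (F := fun v => dist e x v) y). Qed.

Lemma ecc_attained (x : T) : exists y, dist e x y = eccentricity e x.
Proof.
have T_gt0 : (0 < #|T|)%N by apply/card_gt0P; exists x.
by have [y eccE] := eq_bigmax (fun v => dist e x v) T_gt0; exists y.
Qed.

End Distance.

(** * Nonseparable vertex sets, blocks and cycles *)

Section Blocks.
Variables (T : finType) (e : rel T).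
Hypothesis e_simple : simple_graph e.

Local Notation within W := [rel a b | [&& a \in W, b \in W & e a b]].

(** The induced-subgraph version of [nonseparable_subgraph], made a boolean on vertex sets so that
    [maxset] applies to it. *)
Definition nonseparable (W : {set T}) : bool :=
  connected_graph W e && [forall v, ~~ cut_vertex W e v].

Lemma connected_graphP (W : {set T}) (f : rel T) :
  reflect {in W &, forall x y,
             connect [rel a b | [&& a \in W, b \in W & f a b]] x y}
          (connected_graph W f).
Proof.
by apply: (iffP forall_inP) => [h x y xW|h x xW];
  [apply/forall_inP/h | apply/forall_inP => y; apply: h].
Qed.

Lemma connected_graph_sub (W : {set T}) (f g : rel T) :
  subrel f g -> connected_graph W f -> connected_graph W g.
Proof.
move=> fg /connected_graphP Wf; apply/connected_graphP => x y xW yW.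
apply: connect_sub (Wf x y xW yW) => a b /and3P[aW bW /fg ab].
by apply: connect1; rewrite /= aW bW.
Qed.

(** Adding edges of [e] to a nonseparable subgraph keeps it nonseparable, so a larger one has an
    induced nonseparable vertex set, which is [W] by maximality. *)
Lemma nonseparable_maximal_block (W : {set T}) :
  maxset nonseparable W -> block e W (within W).
Proof.
have [e_sym e_irr] := e_simple.
move=> /maxsetP[/andP[Wconn Wcut] Wmax].
have sub_conn V : connected_graph V e -> V \subset W -> connected_graph V (within W).
  move=> /connected_graphP Ve /subsetP VW; apply/connected_graphP => x y xV yV.
  apply: connect_sub (Ve x y xV yV) => a b /and3P[aV bV ab].
  by apply: connect1; rewrite /= aV bV !VW.
split=> [|V f [_ f_in [_ fe] Vconn Vcut] [WV _]].
  split.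
  - split=> [a b|a]; rewrite /= ?e_irr ?andbF // e_sym.
    by rewrite !andbA [(a \in W) && _]andbC.
  - by move=> x y /and3P[-> ->].
  - by split=> [|x y /and3P[]//]; apply: subsetT.
  - exact: sub_conn.
  move=> v; move/forallP/(_ v): Wcut; rewrite /cut_vertex.
  case: (v \in W) => //=; rewrite !negbK => /sub_conn; apply; exact: subD1set.
have VE : V = W.
  apply: Wmax => //; rewrite /nonseparable (connected_graph_sub fe Vconn).
  apply/forallP => v; move: (Vcut v); rewrite /cut_vertex.
  by case: (v \in V) => //=; rewrite !negbK; apply: connected_graph_sub.
by rewrite /subgraph VE; split=> // x y fxy; rewrite /= -VE (fe _ _ fxy) andbT; apply: f_in.
Qed.

Lemma connected_hub (W : {set T}) (h : T) :
  {in W, forall x, connect (within W) h x} -> connected_graph W e.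
Proof.
have [e_sym _] := e_simple.
have W_sym : connect_sym (within W).
  apply: sym_connect_sym => a b /=.
  by rewrite e_sym !andbA [(a \in W) && _]andbC.
move=> hW; apply/connected_graphP => x y xW yW.
by apply: connect_trans (hW y yW); rewrite W_sym; apply: hW.
Qed.

Lemma path_connect_within (W : {set T}) (x : T) (p : seq T) :
  path e x p -> {subset x :: p <= W} ->
  {in x :: p, forall z, connect (within W) x z}.
Proof.
move=> xp pW; apply: path_connect; elim: p x xp pW => //= y p IHp x.
move=> /andP[xy yp] pW; rewrite !pW ?inE ?eqxx ?orbT //= xy /=.
by apply: IHp => // z zp; apply: pW; rewrite inE zp orbT.
Qed.

Local Notation avoiding y := [rel a b | [&& a != y, b != y & e a b]].

Lemma avoiding_sym (y : T) : connect_sym (avoiding y).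
Proof.
apply: sym_connect_sym => a b /=; rewrite e_simple.1.
by rewrite !andbA [(a != y) && _]andbC.
Qed.

(** Without [y] a path starting at [a] remains. Without a vertex of that path, each of the two
    remaining pieces still hangs on [y] by an end of the path. *)
Lemma cycle_nonseparable (y a : T) (p : seq T) :
  uniq (y :: a :: p) -> path e a p -> e y a -> e y (last a p) ->
  nonseparable [set v in y :: a :: p].
Proof.
have [e_sym _] := e_simple.
move=> Uc ap ya yb; set V := [set v in _].
have yNap : y \notin a :: p by case/andP: Uc.
have Uap : uniq (a :: p) by case/andP: Uc.
have conn_path (W : {set T}) : {subset y :: a :: p <= W} ->
    {in a :: p, forall x, connect (within W) y x}.
  move=> VW x xp; apply: (@connect_trans _ _ a); last first.
    by apply: path_connect_within xp => // z zp; apply: VW; rewrite inE zp orbT.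
  by apply: connect1; rewrite /= !VW ?inE ?eqxx ?orbT.
apply/andP; split.
  apply: (connected_hub (h := y)) => x; rewrite inE in_cons => /predU1P[-> //|].
  by apply: conn_path => z zc; rewrite [_ \in V]inE.
apply/forallP => v; rewrite /cut_vertex negb_and negbK -implybE; apply/implyP.
rewrite inE in_cons => /predU1P[->|v_ap].
  apply: (connected_hub (h := a)) => x.
  rewrite in_setD1 [_ \in V]inE in_cons => /andP[/negPf-> /= xp].
  apply: path_connect_within xp => // z zp.
  rewrite in_setD1 [_ \in V]inE in_cons zp orbT andbT; apply: contraNneq yNap => <- //.
have v_y : y != v by apply: contraNneq yNap => ->.
apply: (connected_hub (h := y)) => x.
rewrite in_setD1 [_ \in V]inE in_cons => /andP[x_v /predU1P[-> //|]].
have WP z : z \in a :: p -> z != v -> z \in V :\ v.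
  by move=> zp zv; rewrite in_setD1 zv [_ \in V]inE in_cons zp orbT.
have yW : y \in V :\ v by rewrite !inE v_y eqxx.
have [c1 [c2 E]] : exists c1 c2, a :: p = c1 ++ v :: c2.
  by case/splitPr: v_ap => c1 c2; exists c1, c2.
have sap : sorted e (a :: p) := ap.
have lE : last a p = last y (a :: p) by [].
move: Uap; rewrite E cat_uniq /= negb_or => /and3P[_ /andP[vc1 _] /andP[vc2 _]].
have [c1W c2W] : {subset c1 <= V :\ v} /\ {subset c2 <= V :\ v}.
  split=> z zc; apply: WP; rewrite ?E ?mem_cat ?inE ?zc ?orbT //.
    by apply: contraNneq vc1 => <-.
  by apply: contraNneq vc2 => <-.
rewrite mem_cat inE (negPf x_v) /= => /orP[].
  case: c1 E c1W {vc1} => // a' p1 [<- pE] c1W xc1.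
  apply: (@connect_trans _ _ a); first by apply: connect1; rewrite /= yW c1W ?mem_head.
  by apply: path_connect_within xc1 => //; move: ap; rewrite pE cat_path => /andP[].
case: c2 E c2W {vc2} => // c p2 E c2W xc2.
have cp2 : path e c p2.
  by move: sap; rewrite E => /cat_sorted2[_] /= /andP[].
have lE2 : last a p = last c p2 by rewrite lE E last_cat.
have conn_c := path_connect_within cp2 c2W.
have W_sym : connect_sym (within (V :\ v)).
  apply: sym_connect_sym => u w /=.
  by rewrite e_sym !andbA [(u \in V :\ v) && _]andbC.
apply: (@connect_trans _ _ (last a p)).
  by apply: connect1; rewrite /= yW yb lE2 c2W ?mem_last.
apply: (@connect_trans _ _ c); last exact: conn_c.
by rewrite lE2 W_sym; apply: conn_c; apply: mem_last.
Qed.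

Hypothesis blocks_complete :
  forall (V : {set T}) (f : rel T), block e V f -> complete_graph V f.

Lemma neighbors_adjacent (y a b : T) :
  e y a -> e y b -> a != b -> connect (avoiding y) a b -> e a b.
Proof.
have [e_sym e_irr] := e_simple.
move=> ya yb a_b /connectP[p0 ap0 bE]; move: bE yb a_b.
(* A duplicate-free path from [a] to [b] that avoids [y] closes up through [y] to a cycle. *)
case/shortenP: ap0 => p ap Up _ -> yb a_b.
have y_a : a != y by apply: contraTneq ya => ->; rewrite e_irr.
have e_ap : path e a p by apply: sub_path ap => u w /and3P[].
have yNp : y \notin p.
  elim: p a {Up yb a_b e_ap ya y_a} ap => //= c p IHp a /andP[/and3P[_ cy _] cp].
  by rewrite inE eq_sym (negPf cy) (IHp c).
have Uy : uniq (y :: a :: p) by rewrite cons_uniq Up andbT inE eq_sym (negPf y_a).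
have [W Wmax sW] := maxset_exists (cycle_nonseparable Uy e_ap ya yb).
have inW z : z \in y :: a :: p -> z \in W.
  by move=> zc; apply: (subsetP sW); rewrite inE.
have := blocks_complete (nonseparable_maximal_block Wmax) (inW a _) (inW (last a p) _) a_b.
by case/(_ _ _)/and3P => //; rewrite inE ?mem_last ?mem_head orbT.
Qed.

(** * Parents and siblings with respect to a root *)

Hypothesis e_conn : connected_graph [set: T] e.

(** Along a geodesic from [a] to [r] the distance to [r] drops strictly, so after [a] it stays below
    that of [y]. *)
Lemma avoiding_closer (y r a : T) :
  (dist e a r <= dist e y r)%N -> a != y -> connect (avoiding y) a r.
Proof.
move: {2}(dist e a r) (erefl (dist e a r)) => n.
elim: n a => [|n IHn] a dE le_ay a_y.
  by move/eqP: dE; rewrite dist_eq0 // => /eqP ->.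
have a_r : a != r by rewrite -(dist_eq0 e_conn) dE.
have [b ab dab] := dist_step e_conn a_r.
have b_y : b != y by apply: contraTneq le_ay => <-; rewrite dab ltnn.
apply: (@connect_trans _ _ b); first by apply: connect1; rewrite /= a_y b_y.
by apply: IHn => //; lia.
Qed.

Lemma closer_adjacent (r y a b : T) : e y a -> e y b -> a != b ->
  (dist e a r <= dist e y r)%N -> (dist e b r <= dist e y r)%N -> e a b.
Proof.
have [_ e_irr] := e_simple.
move=> ya yb a_b a_le b_le; apply: neighbors_adjacent (ya) (yb) a_b _.
have neq_y z : e y z -> z != y by apply: contraTneq => ->; rewrite e_irr.
apply: (@connect_trans _ _ r); last rewrite avoiding_sym;
  by apply: avoiding_closer; rewrite ?neq_y.
Qed.

(** Otherwise let [c] be a parent of [a]. The walk from [c] via [r] and [b] to [y] can avoid [a], so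
    the neighbours [c] and [y] of [a] are adjacent, although their depths differ by two. *)
Lemma parent_unique (r y a b : T) : e y a -> e y b ->
  dist e y r = (dist e a r).+1 -> dist e y r = (dist e b r).+1 -> a = b.
Proof.
have [e_sym e_irr] := e_simple.
move=> ya yb da db; apply/eqP/negPn/negP => a_b.
have a_r : a != r.
  apply: contraNneq a_b => ar; rewrite ar distxx // in da.
  by rewrite eq_sym ar -(dist_eq0 e_conn); move: db; rewrite da => -[<-].
have [c ac dc] := dist_step e_conn a_r.
have ab : e a b by apply: (closer_adjacent (r := r) ya yb); rewrite // ?da ?db //; lia.
have c_y : c != y by apply/eqP => cE; move: dc; rewrite cE; lia.
have : e c y.
  have ay : e a y by rewrite e_sym.
  apply: neighbors_adjacent ac ay c_y _.
  have c_a : c != a by apply/eqP => cE; move: dc; rewrite cE; lia.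
  apply: (@connect_trans _ _ r); first by apply: avoiding_closer => //; lia.
  rewrite avoiding_sym; apply: (@connect_trans _ _ b).
    by apply: connect1; rewrite /= yb [b == a]eq_sym a_b !andbT; apply: contraTneq ya => ->; rewrite e_irr.
  by apply: avoiding_closer; rewrite // 1?eq_sym //; lia.
move=> cy; have yc : e y c by rewrite e_sym.
by have := dist_edge e_conn r yc; lia.
Qed.

Lemma sibling_parent (r y z a : T) : e y z -> dist e y r = dist e z r ->
  e y a -> dist e y r = (dist e a r).+1 -> e z a.
Proof.
move=> yz dyz ya da; apply: (closer_adjacent (r := r) yz ya); try lia.
by apply/eqP => zE; move: da; rewrite -zE; lia.
Qed.

Lemma sibling_or_parent (r y z a : T) :
  y != z -> (dist e z r <= dist e y r)%N ->
  e y a -> dist e y r = (dist e a r).+1 ->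
  (e y z /\ dist e y r = dist e z r) \/ dist e y z = (dist e a z).+1.
Proof.
have [e_sym e_irr] := e_simple.
move: {2}(dist e y z) (erefl (dist e y z)) => n.
elim: n y a => [|n IHn] y a dE y_z z_le ya da.
  by move/eqP: dE; rewrite dist_eq0 // (negPf y_z).
have [s ys ds] := dist_step e_conn y_z.
have [<-|s_a] := eqVneq s a; first by right.
have s_y : s != y by apply: contraTneq ys => ->; rewrite e_irr.
have a_y : a != y by apply: contraTneq ya => ->; rewrite e_irr.
have sa : e s a.
  apply: neighbors_adjacent (ys) (ya) s_a _.
  (* The walk avoiding [y] runs from [s] to [z] (here [z] serves as root), on to [r], and from there
     to [a]. *)
  apply: (@connect_trans _ _ z).
    by apply: avoiding_closer => //; lia.
  apply: (@connect_trans _ _ r); first by apply: avoiding_closer => //; rewrite eq_sym.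
  by rewrite avoiding_sym; apply: avoiding_closer => //; lia.
have as_ : e a s by rewrite e_sym.
have sy : e s y by rewrite e_sym.
have s1 := dist_edge e_conn r sa.
have s2 := dist_edge e_conn r ys.
(* Adjacency to [a] bounds the depth of [s] from above; a shallower [s] would be a second parent of
   [y]. *)
have d_s : dist e s r = dist e y r.
  apply/eqP; rewrite eqn_leq; apply/andP; split; first by lia.
  rewrite leqNgt; apply/negP => lt.
  by move/eqP: s_a; apply; apply: parent_unique ys ya _ da; lia.
have [sz|s_z] := eqVneq s z; first by left; rewrite -sz.
have dsr : dist e s r = (dist e a r).+1 by lia.
have z_les : (dist e z r <= dist e s r)%N by lia.
have dsz : dist e s z = n by lia.
(* [a] is also the parent of [s]. A geodesic from [s] to [z] through [a] would make [y] no farther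
   from [z] than [s] is. *)
have [[sz dz]|] := IHn s a dsz s_z z_les sa dsr; last first.
  by move=> dsaz; have := dist_edge e_conn z ya; lia.
left; split; last by lia.
by apply: (closer_adjacent (r := r) sy sz) => //; lia.
Qed.

(* The Gromov product based at [r] is ultrametric; the inequalities bound twice
   that product below by [t]. *)
Lemma gromov_product_ultrametric (r y w z : T) (t : nat) :
  (dist e y w + t <= dist e y r + dist e w r)%N ->
  (dist e w z + t <= dist e w r + dist e z r)%N ->
  (dist e y z + t <= dist e y r + dist e z r)%N.
Proof.
have [e_sym e_irr] := e_simple.
have dsym := dist_sym e_sym e_conn.
have tri := dist_triangle e_conn.
have d1 x x' : e x x' -> dist e x x' = 1%N.
  move=> xx'; have := dist_edge e_conn x' xx'; rewrite distxx //.
  have : dist e x x' != 0%N by rewrite dist_eq0 //; apply: contraTneq xx' => ->; rewrite e_irr.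
  lia.
have [n] := ubnP (dist e y r + dist e w r + dist e z r).
elim: n y w z => // n IHn y w z le_n.
(* The case where an outer vertex is deepest. If its geodesics to both others pass through its
   parent, induction applies to the parent; sibling edges are settled directly. *)
have top y' w' z' : (dist e y' r + dist e w' r + dist e z' r <= n)%N ->
    (dist e w' r <= dist e y' r)%N -> (dist e z' r <= dist e y' r)%N ->
    (dist e y' w' + t <= dist e y' r + dist e w' r)%N ->
    (dist e w' z' + t <= dist e w' r + dist e z' r)%N ->
    (dist e y' z' + t <= dist e y' r + dist e z' r)%N.
  move: y' w' z' => {y w z le_n} y w z le_n wy zy yw wz.
  have [<-|y_z] := eqVneq y z.
    by rewrite distxx //; have := tri w y r; have := tri y w r; rewrite (dsym w y); lia.
  have [yE|y_w] := eqVneq y w; first by rewrite yE.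
  have y_r : y != r.
    by apply: contraNneq y_z => yr; rewrite yr eq_sym -(dist_eq0 e_conn); move: zy; rewrite yr distxx // leqn0.
  have [a ya da] := dist_step e_conn y_r.
  have [[yz' dyz]|dyz] := sibling_or_parent y_z zy ya da.
    have : dist e y w != 0%N by rewrite dist_eq0.
    by rewrite (d1 _ _ yz'); lia.
  have [[yw' dyw]|dyw] := sibling_or_parent y_w wy ya da; last first.
    by have := IHn a w z; lia.
  have wa := sibling_parent yw' dyw ya da.
  have [wz'|w_z] := eqVneq w z; first by rewrite -wz' in zy dyz wz *; have := d1 _ _ yw'; lia.
  have zw : (dist e z r <= dist e w r)%N by lia.
  have dwa : dist e w r = (dist e a r).+1 by lia.
  have [[wz' dwz]|dwz] := sibling_or_parent w_z zw wa dwa; last by lia.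
  suff : e y z by move=> /d1; have := d1 _ _ yw'; lia.
  by apply: (closer_adjacent (r := r) (y := w)); rewrite // 1?e_sym //; lia.
move=> yw wz.
have [wy|yw'] := leqP (dist e w r) (dist e y r).
  have [zy|yz] := leqP (dist e z r) (dist e y r); first by apply: (top y w z) => //; lia.
  by have := top z w y; rewrite (dsym z w) (dsym z y) (dsym w y); lia.
have [wz'|zw] := leqP (dist e w r) (dist e z r).
  by have := top z w y; rewrite (dsym z w) (dsym z y) (dsym w y); lia.
(* Now [w] is strictly deepest and has no sibling edge to [y] or [z]. Moving it to its parent lowers
   both sides of each hypothesis by one. *)
have w_r : w != r by apply: contraTneq yw' => ->; rewrite distxx.
have [a wa da] := dist_step e_conn w_r.
have w_y : w != y by apply: contraTneq yw' => ->; rewrite ltnn.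
have w_z : w != z by apply: contraTneq zw => ->; rewrite ltnn.
have [[_]|dwy] := sibling_or_parent w_y (ltnW yw') wa da; first by lia.
have [[_]|dwz] := sibling_or_parent w_z (ltnW zw) wa da; first by lia.
by have := IHn y a z; rewrite (dsym y w) (dsym y a) in yw *; lia.
Qed.

End Blocks.

(** * Farthest vertices and irreducibility *)

Lemma ultrametric_farthest (T : finType) (e : rel T) (p q u : T) :
  simple_graph e -> clique_tree e ->
  (forall x y, dist e x y <= dist e p q)%N ->
  dist e p u = eccentricity e u \/ dist e q u = eccentricity e u.
Proof.
move=> e_simple [e_conn blocks] pq_max.
have dsym := dist_sym e_simple.1 e_conn.
have [w dw] := ecc_attained e u.
have := dist_le_ecc e u p; have := dist_le_ecc e u q.
rewrite -dw !(dsym u) => le_q le_p.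
have tri := dist_triangle e_conn u p q; rewrite (dsym u q) in tri.
have [->|lt_p] := eqVneq (dist e p u) (dist e w u); first by left.
have [->|lt_q] := eqVneq (dist e q u) (dist e w u); first by right.
(* This [t] is one more than twice the Gromov product of [p] and [q] at [u]. If [w] is farther from
   [u] than [p] and [q] are, maximality of [dist e p q] makes both products with [w] reach [t], a
   contradiction. *)
have := gromov_product_ultrametric e_simple blocks e_conn (r := u) (y := p) (w := w) (z := q)
  (t := (dist e p u + dist e q u).+1 - dist e p q).
by have := pq_max p w; have := pq_max w q; lia.
Qed.

(** [S] collects the indices that the permutation places in the lower block row; the zero block is
    the lower left one. *)
Lemma reducible_zero_block (R : numDomainType) (n : nat) (M : 'M[R]_n) :
  reducible_mx M -> exists S : {set 'I_n},
    [/\ exists i, i \in S, exists j, j \notin S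
      & forall i j, i \in S -> j \notin S -> M i j = 0%R].
Proof.
move=> [n1 [n2 [def_n [P [A [B [C [n1_gt0 n2_gt0 /is_perm_mxP[s PE] ME]]]]]]]].
move: def_n M P s PE ME => def_n; case: n / def_n => M P s -> ->.
rewrite castmx_id tr_perm_mx.
set X := block_mx _ _ _ _.
have XE i j : (perm_mx s^-1%g *m X *m perm_mx s)%R i j = X ((s^-1)%g i) ((s^-1)%g j).
  by rewrite -{2}[s]invgK -col_permE -row_permE !mxE.
exists [set i | (n1 <= (s^-1)%g i)%N]; split.
- by exists (s (rshift n1 (Ordinal n2_gt0))); rewrite inE permK leq_addr.
- by exists (s (lshift n2 (Ordinal n1_gt0))); rewrite inE permK -ltnNge /=.
move=> i j; rewrite !inE -ltnNge XE.
case: (split_ordP ((s^-1)%g i)) => i' ->; first by rewrite leqNgt /= ltn_ord.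
case: (split_ordP ((s^-1)%g j)) => j' -> _; last by [].
by rewrite block_mxEdl mxE.
Qed.

Theorem proposition2p11 (R : numDomainType) (T : finType) (e : rel T)
    (e_simple : simple_graph e) (T_gt1 : (1 < #|T|)%N) (e_CT : in_CT e) :
  irreducible_mx (eccentricity_mx R e).
Proof.
have [e_sym _] := e_simple.
have [e_tree _] := e_CT; have [e_conn _] := e_tree.
have dsym := dist_sym e_sym e_conn.
have /card_gt0P[x0 _] := ltnW T_gt1.
case/reducible_zero_block=> S [[i iS] [j jS] S0].
pose D z := dist e z.1 z.2.
have [[p q] _ pq_max] := @arg_maxnP _ (x0, x0) predT D isT.
have {}pq_max x y : (dist e x y <= dist e p q)%N := pq_max (x, y) isT.
pose A := [set x | enum_rank x \in S].
(* Both the [(x, y)] and the [(y, x)] entry are nonzero. The zero block excludes only entries from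
   [S] to its complement, so each inclusion uses one of them. *)
have A_closed x y : x != y -> dist e x y = eccentricity e x -> (x \in A) = (y \in A).
  move=> x_y dxE.
  have le_ecc : (eccentricity e x <= eccentricity e y)%N.
    by rewrite -dxE dsym dist_le_ecc.
  have nz : ((dist e x y)%:R != 0 :> R)%R by rewrite pnatr_eq0 dist_eq0.
  have min_l : dist e x y == minn (eccentricity e x) (eccentricity e y).
    by rewrite (minn_idPl le_ecc) dxE.
  rewrite !inE; apply/idP/idP => [xS|yS]; apply/negPn/negP.
    move=> /(S0 _ _ xS)/eqP; rewrite mxE /= !enum_rankK min_l; exact/negP.
  move=> /(S0 _ _ yS)/eqP.
  rewrite mxE /= !enum_rankK minnC dsym min_l; exact/negP.
have ecc_p : dist e p q = eccentricity e p.
  apply/eqP; rewrite eqn_leq dist_le_ecc.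
  by have [y <-] := ecc_attained e p; apply: pq_max.
have pq : p != q.
  have /card_gt1P[x [y [_ _ x_y]]] := T_gt1.
  by rewrite -(dist_eq0 e_conn) -lt0n (leq_trans _ (pq_max x y)) // lt0n dist_eq0.
have A_const u : (u \in A) = (p \in A).
  have [<- //|u_p] := eqVneq u p.
  have [->|u_q] := eqVneq u q; first by rewrite (A_closed p q).
  have [duE|duE] := ultrametric_farthest u e_simple e_tree pq_max.
    by rewrite (A_closed u p) // dsym.
  by rewrite (A_closed u q) 1?dsym // (A_closed p q).
have := A_const (enum_val j); rewrite -(A_const (enum_val i)) !inE !enum_valK.
by rewrite iS (negPf jS).
Qed.
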